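(* Let $\lambda$ be an uncountable regular cardinal, let $\varepsilon\in[0,\infty]$, and let $\mathcal{K}$ be a $\mathbf{Met}_\infty$-enriched category with $\lambda$-directed colimits, such that the underlying ordinary category $\mathcal{K}_0$ is locally $\lambda$-presentable and every object that is $\lambda$-presentable in $\mathcal{K}_0$ is $\lambda$-presentable in $\mathcal{K}$. Then every class $\mathcal{L}$ of objects in $\mathcal{K}$ that is closed under products, $\lambda$-directed colimits and weakly $\lambda$-$\varepsilon$-pure morphisms is a $\lambda$-$\varepsilon$-injectivity class and, in particular, a small injectivity class.
   Context: $\mathbf{Met}_\infty$ is the category of generalized metric spaces (metric spaces whose distance may take the value $\infty$) and non-expansive maps. It is monoidal closed with $X\otimes Y$ the cartesian product of sets with the sum metric $d((x,y),(x',y'))=d(x,x')+d(y,y')$, and internal hom the set of non-expansive maps with the sup-metric. A $\mathbf{Met}_\infty$-enriched category $\mathcal{K}$ thus has hom-sets $\mathcal{K}(A,B)$ carrying generalized metrics $d$ such that the composition maps $\mathcal{K}(B,C)\otimes\mathcal{K}(A,B)\to\mathcal{K}(A,C)$ are non-expansive; $\mathcal{K}_0$ is its underlying ordinary category. Limits and colimits in $\mathcal{K}$ are conical: limits in $\mathcal{K}_0$ preserved by all $\mathcal{K}(K,-):\mathcal{K}_0\to\mathbf{Met}_\infty$, respectively colimits in $\mathcal{K}_0$ preserved by all $\mathcal{K}(-,K):\mathcal{K}_0^{op}\to\mathbf{Met}_\infty$. For parallel morphisms $f,g:A\to B$ write $f\sim_\varepsilon g$ if $d(f,g)\le\varepsilon$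 in $\mathcal{K}(A,B)$. An object $K$ is $\lambda$-presentable in $\mathcal{K}_0$ if $\mathcal{K}_0(K,-):\mathcal{K}_0\to\mathbf{Set}$ preserves $\lambda$-directed colimits, and $\lambda$-presentable in $\mathcal{K}$ if $\mathcal{K}(K,-):\mathcal{K}\to\mathbf{Met}_\infty$ preserves $\lambda$-directed colimits. A morphism $f:K\to L$ is weakly $\lambda$-$\varepsilon$-pure if for all $A,B$ $\lambda$-presentable in $\mathcal{K}$ and all $g:A\to B$, $u:A\to K$, $v:B\to L$ with $fu\sim_\varepsilon vg$ there is $t:B\to K$ with $tg\sim_{2\varepsilon}u$. A class $\mathcal{L}$ of objects is closed under weakly $\lambda$-$\varepsilon$-pure morphisms if for every weakly $\lambda$-$\varepsilon$-pure $K\to L$ with $L\in\mathcal{L}$ one has $K\in\mathcal{L}$. An object $K$ is $\varepsilon$-injective to $f:A\to B$ if for every $g:A\to K$ there is $h:B\to K$ with $hf\sim_\varepsilon g$. For a class $\mathcal{F}$ of morphisms, $\mathrm{Inj}_\varepsilon\mathcal{F}$ is the class of objects $\varepsilon$-injective to every $f\in\mathcal{F}$. It is called a $\lambda$-$\varepsilon$-injectivity class if the domains and codomains of all morphisms in $\mathcal{F}$ are $\lambda$-presentable in $\mathcal{K}$. A small injectivity class is a class of the form $\mathrm{Inj}_0\mathcal{F}$ with $\mathcal{F}$ a set (i.e. ordinary injectivity with respect to a set of morphisms).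
   Formalization: Closure under products is taken for all products of K_0, not only conical ones; with conical products alone the claim fails (vector spaces with d(f,g)=rank(f-g), ε=0, spaces of dimension at most 5). *)

(* Defs.v *)
From mathcomp Require Import all_boot all_order all_algebra.
From mathcomp Require Import all_classical all_reals.

Set Implicit Arguments.
Unset Strict Implicit.
Unset Printing Implicit Defensive.

Import Order.TTheory GRing.Theory Num.Theory.

Local Open Scope classical_set_scope.
Local Open Scope card_scope.

(* A single fixed universe plays the role of the universe of (small) sets:
   hom-sets, index sets, carriers of metric spaces and cardinals live in it,
   whereas collections of objects may be larger. *)
Definition SmallType := Type.
Identity Coercion sort_of_small : SmallType >-> Sortclass.

(* A cardinal is represented by any small type of that cardinality. *)
Definition card_lt (T U : SmallType) (A : set T) (B : set U) : Prop :=
  (A #<= B) /\ (A #!= B).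

Definition regular_cardinal (Lam : SmallType) : Prop :=
  infinite_set [set: Lam] /\
  forall (I : SmallType) (X : I -> SmallType),
    card_lt [set: I] [set: Lam] ->
    (forall i, card_lt [set: X i] [set: Lam]) ->
    card_lt [set: {i : I & X i}] [set: Lam].

Record isCategory (ob : Type) := IsCategory {
  ic_hom : ob -> ob -> SmallType;
  ic_id : forall a, ic_hom a a;
  ic_comp : forall a b c, ic_hom b c -> ic_hom a b -> ic_hom a c;
  ic_id_l : forall a b (f : ic_hom a b), ic_comp (ic_id b) f = f;
  ic_id_r : forall a b (f : ic_hom a b), ic_comp f (ic_id a) = f;
  ic_assoc : forall a b c d (h : ic_hom c d) (g : ic_hom b c) (f : ic_hom a b),
    ic_comp h (ic_comp g f) = ic_comp (ic_comp h g) f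
}.

Arguments ic_id {ob} _ _.
Arguments ic_comp {ob} _ {a b c} _ _.

Record category := Category {
  ob :> Type;
  ob_isCategory : isCategory ob
}.

Definition Hom (C : category) (a b : C) : SmallType :=
  ic_hom (ob_isCategory C) a b.
Definition idm (C : category) (a : C) : Hom a a := ic_id (ob_isCategory C) a.
Definition mcomp (C : category) (a b c : C) (g : Hom b c) (f : Hom a b) :
  Hom a c := ic_comp (ob_isCategory C) g f.

Notation "g <o> f" := (mcomp g f) (at level 40, left associativity).

Record smallCategory := SmallCategory {
  sob :> SmallType;
  sob_isCategory : isCategory sob
}.

Definition category_of_small (J : smallCategory) : category :=
  Category (sob_isCategory J).
Coercion category_of_small : smallCategory >-> category.

Definition op_isCategory (C : category) : isCategory C.
Proof.
pose s := ob_isCategory C.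
apply: (@IsCategory C (fun a b => ic_hom s b a) (fun a => ic_id s a)
  (fun a b c g f => ic_comp s f g)).
- by move=> a b f; apply: ic_id_r.
- by move=> a b f; apply: ic_id_l.
- by move=> a b c d h g f; rewrite ic_assoc.
Defined.

Definition op (C : category) : category := Category (op_isCategory C).

Record functor (C D : category) := Functor {
  fob :> C -> D;
  fmap : forall a b : C, Hom a b -> Hom (fob a) (fob b);
  fmap_id : forall a : C, fmap (idm a) = idm (fob a);
  fmap_comp : forall (a b c : C) (g : Hom b c) (f : Hom a b),
    fmap (g <o> f) = fmap g <o> fmap f
}.

Definition fcomp (C D E : category) (G : functor D E) (F : functor C D) :
  functor C E.
Proof.
apply: (@Functor C E (fun a => G (F a)) (fun a b f => fmap G (fmap F f))).
- by move=> a; rewrite !fmap_id.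
- by move=> a b c g f; rewrite !fmap_comp.
Defined.

Definition fop (C D : category) (F : functor C D) : functor (op C) (op D).
Proof.
apply: (@Functor (op C) (op D) (fun a => F a)
  (fun a b (f : @Hom C b a) => fmap F f)).
- by move=> a; exact: (fmap_id F a).
- by move=> a b c g f; exact: (fmap_comp F f g).
Defined.

Record cocone (J C : category) (D : functor J C) (c : C) := Cocone {
  inj : forall j : J, Hom (D j) c;
  inj_nat : forall (i j : J) (f : Hom i j), inj j <o> fmap D f = inj i
}.

Record cone (J C : category) (D : functor J C) (c : C) := Cone {
  prj : forall j : J, Hom c (D j);
  prj_nat : forall (i j : J) (f : Hom i j), fmap D f <o> prj i = prj j
}.

Definition is_colimit (J C : category) (D : functor J C) (c : C)
    (s : cocone D c) : Prop :=
  forall (x : C) (t : cocone D x),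
    exists! u : Hom c x, forall j : J, u <o> inj s j = inj t j.

Definition is_limit (J C : category) (D : functor J C) (c : C)
    (s : cone D c) : Prop :=
  forall (x : C) (t : cone D x),
    exists! u : Hom x c, forall j : J, prj s j <o> u = prj t j.

Definition map_cocone (J C E : category) (F : functor C E) (D : functor J C)
    (c : C) (s : cocone D c) : cocone (fcomp F D) (F c).
Proof.
apply: (@Cocone J E (fcomp F D) (F c) (fun j => fmap F (inj s j))).
by move=> i j f; rewrite -(inj_nat s f) fmap_comp.
Defined.

Definition map_cone (J C E : category) (F : functor C E) (D : functor J C)
    (c : C) (s : cone D c) : cone (fcomp F D) (F c).
Proof.
apply: (@Cone J E (fcomp F D) (F c) (fun j => fmap F (prj s j))).
by move=> i j f; rewrite -(prj_nat s f) fmap_comp.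
Defined.

Definition op_cocone (J C : category) (D : functor J C) (c : C)
    (s : cocone D c) : cone (fop D) (c : op C).
Proof.
apply: (@Cone (op J) (op C) (fop D) c (fun j => inj s j)).
by move=> i j f; exact: (inj_nat s f).
Defined.

Definition is_product (C : category) (I : SmallType) (X : I -> C) (p : C)
    (pi : forall i, Hom p (X i)) : Prop :=
  forall (x : C) (f : forall i, Hom x (X i)),
    exists! u : Hom x p, forall i, pi i <o> u = f i.

Definition cocomplete (C : category) : Prop :=
  forall (J : smallCategory) (D : functor J C),
    exists (c : C) (s : cocone D c), is_colimit s.

Record poset := Poset {
  pcar :> SmallType;
  ple : pcar -> pcar -> Prop;
  ple_refl : forall x, ple x x;
  ple_trans : forall x y z, ple x y -> ple y z -> ple x z;
  ple_antisym : forall x y, ple x y -> ple y x -> x = y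
}.

Definition lam_directed (Lam : SmallType) (P : poset) : Prop :=
  forall S : set P, card_lt S [set: Lam] ->
    exists u : P, forall x, S x -> ple x u.

Definition poset_isCategory (P : poset) : isCategory P.
Proof.
apply: (@IsCategory P (fun x y => ple x y : SmallType) (fun x => ple_refl x)
  (fun x y z g f => ple_trans f g)).
- by move=> a b f; exact: Prop_irrelevance.
- by move=> a b f; exact: Prop_irrelevance.
- by move=> a b c d h g f; exact: Prop_irrelevance.
Defined.

Definition poset_category (P : poset) : smallCategory :=
  SmallCategory (poset_isCategory P).
Coercion poset_category : poset >-> smallCategory.

Definition preserves_directed_colimits (Lam : SmallType) (C E : category)
    (F : functor C E) : Prop :=
  forall (P : poset) (D : functor P C) (c : C) (s : cocone D c),
    lam_directed Lam P -> is_colimit s -> is_colimit (map_cocone F s).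

Definition Set_isCategory : isCategory SmallType.
Proof.
by apply: (@IsCategory SmallType (fun X Y => X -> Y) (fun X x => x)
  (fun X Y Z g f x => g (f x))).
Defined.

Definition SetCat : category := Category Set_isCategory.

Definition hom_functor (C : category) (K : C) : functor C SetCat.
Proof.
apply: (@Functor C SetCat (fun X => Hom K X) (fun X Y f g => f <o> g)).
- by move=> X; apply/funext => g; exact: ic_id_l.
- by move=> X Y Z g f; apply/funext => h; symmetry; exact: ic_assoc.
Defined.

Definition presentable (Lam : SmallType) (C : category) (K : C) : Prop :=
  preserves_directed_colimits Lam (hom_functor K).

Definition locally_presentable (Lam : SmallType) (C : category) : Prop :=
  cocomplete C /\
  exists (S : SmallType) (G : S -> C),
    (forall s, presentable Lam (G s)) /\
    forall X : C, exists (P : poset) (D : functor P C) (s : cocone D X),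
      [/\ lam_directed Lam P, is_colimit s
        & forall p : P, exists i : S, D p = G i].

Local Open Scope ereal_scope.

Record is_gmetric (R : realType) (T : SmallType) (d : T -> T -> \bar R) :
    Prop := IsGMetric {
  gm_ge0 : forall x y, 0 <= d x y;
  gm_refl : forall x, d x x = 0;
  gm_eq : forall x y, d x y = 0 -> x = y;
  gm_sym : forall x y, d x y = d y x;
  gm_triangle : forall x y z, d x z <= d x y + d y z
}.

Record gmetric (R : realType) := GMetric {
  gcar :> SmallType;
  gdist : gcar -> gcar -> \bar R;
  gdist_is_gmetric : is_gmetric gdist
}.

Definition non_expansive (R : realType) (X Y : gmetric R) (f : X -> Y) : Prop :=
  forall x x', gdist (f x) (f x') <= gdist x x'.

Definition Met_isCategory (R : realType) : isCategory (gmetric R).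
Proof.
unshelve eapply (@IsCategory (gmetric R)
  (fun X Y => {f : X -> Y | non_expansive f} : SmallType)
  (fun X => exist _ (fun x : X => x) _)
  (fun X Y Z g f => exist _ (fun x => sval g (sval f x)) _)).
- by move=> x x'.
- by move=> x x'; exact: le_trans (svalP g _ _) (svalP f _ _).
- by move=> X Y [f f_ne]; exact: eq_exist.
- by move=> X Y [f f_ne]; exact: eq_exist.
- by move=> X Y Z W h g f; exact: eq_exist.
Defined.

Definition MetCat (R : realType) : category := Category (Met_isCategory R).

(* [mcat] is the underlying ordinary category.  [mdist_comp] says that
   composition is non-expansive for the sum metric on pairs of morphisms. *)
Record metCategory (R : realType) := MetCategory {
  mcat :> category;
  mdist : forall A B : mcat, Hom A B -> Hom A B -> \bar R;
  mdist_is_gmetric : forall A B : mcat, is_gmetric (@mdist A B);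
  mdist_comp : forall (A B C : mcat) (g g' : Hom B C) (f f' : Hom A B),
    mdist (g <o> f) (g' <o> f') <= mdist g g' + mdist f f'
}.

Definition hom_met (R : realType) (K : metCategory R) (A B : K) : gmetric R :=
  GMetric (mdist_is_gmetric A B).

Lemma post_non_expansive (R : realType) (K : metCategory R) (A X Y : K)
  (f : Hom X Y) :
  @non_expansive R (hom_met A X) (hom_met A Y) (fun g => f <o> g).
Proof.
move=> g g'; apply: le_trans (mdist_comp f f g g') _.
by rewrite (gm_refl (mdist_is_gmetric _ _)) add0e.
Qed.

Lemma pre_non_expansive (R : realType) (K : metCategory R) (X Y B : K)
  (f : Hom X Y) :
  @non_expansive R (hom_met Y B) (hom_met X B) (fun g => g <o> f).
Proof.
move=> g g'; apply: le_trans (mdist_comp g g' f f) _.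
by rewrite (gm_refl (mdist_is_gmetric _ _)) adde0.
Qed.

Definition met_hom_functor (R : realType) (K : metCategory R) (A : K) :
  functor K (MetCat R).
Proof.
apply: (@Functor K (MetCat R) (fun X => hom_met A X)
  (fun X Y f => exist _ _ (post_non_expansive (A := A) f))).
- by move=> X; apply/eq_exist/funext => g; exact: ic_id_l.
- by move=> X Y Z g f; apply/eq_exist/funext => h; symmetry; exact: ic_assoc.
Defined.

Definition met_cohom_functor (R : realType) (K : metCategory R) (B : K) :
  functor (op K) (MetCat R).
Proof.
apply: (@Functor (op K) (MetCat R) (fun X => hom_met (X : K) B)
  (fun (X Y : op K) (f : @Hom K Y X) =>
     exist _ _ (pre_non_expansive (B := B) f))).
- by move=> X; apply/eq_exist/funext => g; exact: ic_id_r.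
- by move=> X Y Z g f; apply/eq_exist/funext => h; exact: ic_assoc.
Defined.

Definition is_conical_colimit (R : realType) (K : metCategory R) (J : category)
    (D : functor J K) (c : K) (s : cocone D c) : Prop :=
  is_colimit s /\
  forall B : K, is_limit (map_cone (met_cohom_functor B) (op_cocone s)).

Definition has_directed_colimits (Lam : SmallType) (R : realType)
    (K : metCategory R) : Prop :=
  forall (P : poset) (D : functor P K), lam_directed Lam P ->
    exists (c : K) (s : cocone D c), is_conical_colimit s.

Definition met_presentable (Lam : SmallType) (R : realType)
    (K : metCategory R) (A : K) : Prop :=
  forall (P : poset) (D : functor P K) (c : K) (s : cocone D c),
    lam_directed Lam P -> is_conical_colimit s ->
    is_colimit (map_cocone (met_hom_functor A) s).

Definition esim (R : realType) (K : metCategory R) (eps : \bar R) (A B : K)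
    (f g : Hom A B) : Prop := mdist f g <= eps.

Definition weakly_pure (Lam : SmallType) (R : realType) (eps : \bar R)
    (K : metCategory R) (X Y : K) (f : Hom X Y) : Prop :=
  forall A B : K, met_presentable Lam A -> met_presentable Lam B ->
  forall (g : Hom A B) (u : Hom A X) (v : Hom B Y),
    esim eps (f <o> u) (v <o> g) ->
    exists t : Hom B X, esim (2%:E * eps) (t <o> g) u.

Definition closed_under_weakly_pure (Lam : SmallType) (R : realType)
    (eps : \bar R) (K : metCategory R) (L : K -> Prop) : Prop :=
  forall (X Y : K) (f : Hom X Y), weakly_pure Lam eps f -> L Y -> L X.

Definition closed_under_directed_colimits (Lam : SmallType) (R : realType)
    (K : metCategory R) (L : K -> Prop) : Prop :=
  forall (P : poset) (D : functor P K) (c : K) (s : cocone D c),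
    lam_directed Lam P -> is_conical_colimit s -> (forall p : P, L (D p)) ->
    L c.

(* The products are those of the underlying category, whether conical or not:
   for tolerance 0, every injectivity class is closed under all of them, while
   closure under the conical ones alone does not make a class an injectivity
   class. *)
Definition closed_under_products (C : category) (L : C -> Prop) : Prop :=
  forall (I : SmallType) (X : I -> C) (p : C) (pi : forall i, Hom p (X i)),
    is_product pi -> (forall i, L (X i)) -> L p.

Definition injective_to (R : realType) (eps : \bar R) (K : metCategory R)
    (A B : K) (f : Hom A B) (X : K) : Prop :=
  forall g : Hom A X, exists h : Hom B X, esim eps (h <o> f) g.

(* [F] is a class of morphisms, possibly large. *)
Definition Inj (R : realType) (eps : \bar R) (K : metCategory R)
    (F : forall A B : K, Hom A B -> Prop) (X : K) : Prop :=
  forall (A B : K) (f : Hom A B), F A B f -> injective_to eps f X.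

Definition injectivity_class (Lam : SmallType) (R : realType) (eps : \bar R)
    (K : metCategory R) (L : K -> Prop) : Prop :=
  exists F : forall A B : K, Hom A B -> Prop,
    (forall (A B : K) (f : Hom A B), F A B f ->
       met_presentable Lam A /\ met_presentable Lam B) /\
    forall X : K, L X <-> Inj eps F X.

(* A set of morphisms is given as a family indexed by a small type. *)
Definition small_injectivity_class (R : realType) (K : metCategory R)
    (L : K -> Prop) : Prop :=
  exists (I : SmallType) (A B : I -> K) (f : forall i, Hom (A i) (B i)),
    forall X : K, L X <-> forall i, injective_to 0 (f i) X.

(* Main.v *)
Require Import Defs.
From mathcomp Require Import all_boot all_order all_algebra.
From mathcomp Require Import all_classical all_reals.
From mathcomp Require Import ereal.
(* [Hom] is to denote the hom-sets of a category, not the linear maps between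
   vector spaces. *)
Import Defs.

(** The theorem rests on one construction, for an arbitrary tolerance [eps].
    Let [G] be a small family of presentable objects such that each object is a
    directed colimit of members of [G], and let [F] be the set of morphisms
    between members of [G] to which every object of [L] is [eps]-injective.
    The claim is that an object [X] which is [eps]-injective to [F] is in [L].

    Write [X] as the directed colimit of objects [D j] of [G]. Closure under
    products gives for each [j] a map [h j : D j -> Z j] into an object of [L]
    which factors through a map [k] to a member of [G] only if [k] is in [F]:
    multiply together a witness for each [k] outside [F] ([detecting_map]).
    The products [Q i] of the [Z j] for [j >= i] form a directed diagram under
    the projections; its colimit [q], a reduced product of the [Z j], is in [L],
    and the maps [h j] induce a morphism [r : X -> q].

    This [r] is weakly [eps]-pure. If [r u] is within [eps] of [v g], then,
    distances in uncountably directed colimits being attained at some stage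
    ([met_colimit_dist]), the square lives over some [Q k]; projecting to [Z k]
    it becomes a square over [h k]. Such a square lives over a member [C] of [G]
    ([square_factor]), so that [h k] factors through a map [D k -> C], which is
    then in [F]. As [X] is [eps]-injective to it, there is a map [C -> X] giving
    the required [t], at the cost of a second [eps]. Hence [X] is in [L]
    ([injective_in_class]).

    For the small injectivity class, the same construction is used with the
    tolerance 0: it applies because a weakly [0]-pure morphism is weakly
    [eps]-pure ([weakly_pure0]).

    The argument needs products in the underlying category, which is only
    assumed to be cocomplete. They are obtained as terminal cones, following
    Freyd: the colimit of all members of [G] over the given family is a weakly
    terminal cone, and coequalizing its endomorphisms makes it terminal
    ([product_exists]). *)

Set Implicit Arguments.
Unset Strict Implicit.
Unset Printing Implicit Defensive.

Import Order.TTheory GRing.Theory Num.Theory.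

Local Open Scope classical_set_scope.

(** * Products in a cocomplete category with a generating family *)

Lemma mcompA (C : category) (a b c d : C) (h : Hom c d) (g : Hom b c)
  (f : Hom a b) : h <o> (g <o> f) = h <o> g <o> f.
Proof. exact: ic_assoc. Qed.

Lemma mcomp1f (C : category) (a b : C) (f : Hom a b) : idm b <o> f = f.
Proof. exact: ic_id_l. Qed.

Lemma mcompf1 (C : category) (a b : C) (f : Hom a b) : f <o> idm a = f.
Proof. exact: ic_id_r. Qed.

Lemma colimit_epi (J C : category) (D : functor J C) (c : C) (s : cocone D c) :
  is_colimit s -> forall (x : C) (u v : Hom c x),
  (forall j, u <o> inj s j = v <o> inj s j) -> u = v.
Proof.
move=> sP x u v uv.
have tP (i j : J) (f : Hom i j) : v <o> inj s j <o> fmap D f = v <o> inj s i.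
  by rewrite -mcompA inj_nat.
have [w [_ w_uniq]] := sP x (Cocone tP).
by rewrite -(w_uniq u) // -(w_uniq v).
Qed.

(** The shape of a joint coequalizer: [None] is the common codomain, and each
    [Some i] has two arrows, named by the booleans, to [None]. *)
Definition fork_hom (I : SmallType) (x y : option I) : SmallType :=
  match x, y with
  | Some i, Some j => i = j
  | Some _, None => bool
  | None, Some _ => Empty_set
  | None, None => unit
  end.

Definition fork_id (I : SmallType) (x : option I) : fork_hom x x :=
  if x is Some i then erefl i else tt.

Definition fork_comp (I : SmallType) (x y z : option I) :
  fork_hom y z -> fork_hom x y -> fork_hom x z.
Proof.
by case: x y z => [a|] [b|] [c|] //= bc ab; exact: etrans ab bc.
Defined.

Definition fork_isCategory (I : SmallType) : isCategory (option I).
Proof.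
apply: (@IsCategory (option I) (@fork_hom I) (@fork_id I) (@fork_comp I)).
- by move=> [a|] [b|] //= f; case: _ / f.
- by move=> [a|] [b|] //= f; case: f.
- by move=> [a|] [b|] [c|] [d|] //= h k l.
Defined.

Definition fork (I : SmallType) : smallCategory :=
  SmallCategory (fork_isCategory I).

Section JointCoequalizer.
Variables (C : category) (I : SmallType) (Y : I -> C) (e : C).
Variables (f g : forall i, Hom (Y i) e).

Definition fork_ob (x : option I) : C := if x is Some i then Y i else e.

Definition fork_fmap (x y : option I) :
  fork_hom x y -> Hom (fork_ob x) (fork_ob y) :=
  match x, y with
  | Some i, Some j => fun ij : i = j =>
      match ij in _ = k return Hom (Y i) (Y k) with erefl => idm (Y i) end
  | Some i, None => fun b : bool => if b then f i else g i
  | None, Some _ => fun v : Empty_set => match v with end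
  | None, None => fun=> idm e
  end.

Definition fork_functor : functor (fork I) C.
Proof.
apply: (@Functor (fork I) C fork_ob fork_fmap); first by case.
move=> [a|] [b|] [c|] //= k h; rewrite ?mcomp1f //.
- by move: k h; rewrite /Hom/= => k; case: _ / k => h; rewrite mcomp1f.
- by case: b / h in k *; rewrite mcompf1.
Defined.

Lemma joint_coequalizer : cocomplete C ->
  exists (z : C) (q : Hom e z), (forall i, q <o> f i = q <o> g i) /\
    forall (z' : C) (q' : Hom e z'), (forall i, q' <o> f i = q' <o> g i) ->
      exists! w : Hom z z', w <o> q = q'.
Proof.
move=> /(_ (fork I) fork_functor)[z [s sP]]; exists z, (inj s None).
have sN i (b : bool) : inj s None <o> (if b then f i else g i) = inj s (Some i).
  exact: (@inj_nat (fork I) C fork_functor z s (Some i) None b).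
split=> [i|z' q' q'E]; first by rewrite (sN i true) (sN i false).
pose t (x : option I) : Hom (fork_ob x) z' :=
  if x is Some i then q' <o> f i else q'.
have tP (x y : option I) (h : fork_hom x y) : t y <o> fork_fmap h = t x.
  case: x y h => [a|] [b|] //= h; rewrite ?mcompf1 //.
  - by case: b / h; rewrite mcompf1.
  - by case: h.
have [w [wP w_uniq]] := sP z' (@Cocone (fork I) C fork_functor z' t tP).
exists w; split=> [|v vE]; first exact: (wP None).
apply: w_uniq => -[i|] //=; rewrite -(sN i true) mcompA.
by rewrite vE.
Qed.

End JointCoequalizer.

Section Products.
Variables (C : category) (S : SmallType) (G : S -> C).
Hypothesis C_cocomplete : cocomplete C.

(** The objects that are equal to a member of the family [G]. *)
Definition in_family (c : C) : Prop := exists i, c = G i.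

(* Each object is a colimit of a small diagram of members of [G]. *)
Hypothesis G_gen : forall X : C,
  exists (P : smallCategory) (D : functor P C) (s : cocone D X),
    is_colimit s /\ forall p, in_family (D p).

Variables (I : SmallType) (X : I -> C).

(** The small category of the cones over [X] whose vertex is a member of [G];
    its morphisms are the maps of the vertices compatible with the cones. *)
Definition elt : SmallType := {s : S & forall i, Hom (G s) (X i)}.

Definition Elt s (psi : forall i, Hom (G s) (X i)) : elt := existT _ s psi.

Definition elt_hom (x y : elt) : SmallType :=
  {h : Hom (G (tag x)) (G (tag y)) |
    forall i, tagged y i <o> h = tagged x i}.

Definition elt_isCategory : isCategory elt.
Proof.
unshelve eapply (@IsCategory elt elt_hom).
- by move=> x; exists (idm _) => i; exact: mcompf1.
- move=> x y z g f; exists (sval g <o> sval f) => i.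
  by rewrite mcompA (svalP g) (svalP f).
- by move=> x y [f fP]; apply: eq_exist; exact: mcomp1f.
- by move=> x y [f fP]; apply: eq_exist; exact: mcompf1.
- by move=> x y z w [h hP] [g gP] [f fP]; apply: eq_exist; exact: mcompA.
Defined.

Definition elt_category : smallCategory := SmallCategory elt_isCategory.

Definition elt_functor : functor elt_category C.
Proof.
by apply: (@Functor elt_category C (fun x : elt => G (tag x))
  (fun (x y : elt) (h : elt_hom x y) => sval h)).
Defined.

(** The colimit of all these vertices carries a cone over [X], to which every
    cone maps: write the vertex as a colimit of members of [G]. *)
Lemma weakly_terminal_cone : exists (c : C) (gam : forall i, Hom c (X i)),
  forall (Y : C) (phi : forall i, Hom Y (X i)),
    exists h : Hom Y c, forall i, gam i <o> h = phi i.
Proof.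
have [c [s sP]] := C_cocomplete elt_functor.
have injE (x y : elt) (h : Hom (G (tag x)) (G (tag y))) :
    (forall i, tagged y i <o> h = tagged x i) ->
    inj s (y : elt_category) <o> h = inj s (x : elt_category).
  move=> hP.
  exact: (@inj_nat _ _ elt_functor c s x y (exist _ h hP)).
have gam_ex i : exists gam : Hom c (X i), forall x : elt,
    gam <o> inj s (x : elt_category) = tagged x i.
  have tP (x y : elt) (f : elt_hom x y) : tagged y i <o> sval f = tagged x i.
    exact: (svalP f).
  have [u [uP _]] := sP (X i)
    (@Cocone elt_category C elt_functor (X i) (fun x : elt => tagged x i) tP).
  by exists u.
pose gam i := projT1 (cid (gam_ex i)).
have gamP i x : gam i <o> inj s x = tagged x i := projT2 (cid (gam_ex i)) x.
exists c, gam => Y phi.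
(* [can psi] is the leg of the colimit at the cone [psi]; it is described by its
   composites, so that the members of [G] need not be named. *)
have can_ex (Z : C) : in_family Z ->
    exists can : (forall i, Hom Z (X i)) -> Hom Z c,
    (forall psi i, gam i <o> can psi = psi i) /\
    forall psi t (h : Hom (G t) Z),
      can psi <o> h = inj s (Elt (fun i => psi i <o> h)).
  case=> t ->; exists (fun psi => inj s (Elt psi)); split.
    by move=> psi i; exact: (gamP i (Elt psi)).
  by move=> psi t' h; apply: (@injE (Elt _) (Elt psi)).
have [P [D [t [tP DG]]]] := G_gen Y.
pose can p := projT1 (cid (can_ex (D p) (DG p))).
have gam_can p psi i : gam i <o> can p psi = psi i.
  exact: (projT2 (cid (can_ex (D p) (DG p)))).1.
have canE p psi t' (h : Hom (G t') (D p)) : can p psi <o> h =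
    inj s (Elt (fun i => psi i <o> h)).
  exact: (projT2 (cid (can_ex (D p) (DG p)))).2.
have can_nat p q psi (h : Hom (D p) (D q)) :
    can q psi <o> h = can p (fun i => psi i <o> h).
  move: (can p) (canE p) (DG p) h => canp canpE [t' DpE].
  case: _ / (esym DpE) in canp canpE * => h.
  rewrite canE -[RHS]mcompf1 canpE; congr (inj s (Elt _)).
  by apply: functional_extensionality_dep => i; rewrite mcompf1.
have uP (p q : P) (f : @Hom P p q) :
    can q (fun i => phi i <o> inj t q) <o> fmap D f =
    can p (fun i => phi i <o> inj t p).
  rewrite can_nat; congr (can p _); apply: functional_extensionality_dep => i.
  by rewrite -mcompA inj_nat.
have [u [uE _]] :=
  tP c (@Cocone P C D c (fun p => can p (fun i => phi i <o> inj t p)) uP).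
exists u => i; apply: (colimit_epi tP) => p.
by rewrite -mcompA uE /= gam_can.
Qed.

(** Freyd's construction of a terminal object, for cones over [X]: a weakly
    terminal cone is made terminal by coequalizing all its endomorphisms. *)
Lemma product_exists : exists (p : C) (pi : forall i, Hom p (X i)),
  is_product pi.
Proof.
have [c [gam gam_weak]] := weakly_terminal_cone.
pose E := {k : Hom c c | forall i, gam i <o> k = gam i} : SmallType.
have [e [q [qE q_univ]]] := joint_coequalizer (fun k : E => sval k)
  (fun=> idm c) C_cocomplete.
have del_ex i : exists del : Hom e (X i), del <o> q = gam i.
  have [|d [dP _]] := q_univ _ (gam i); last by exists d.
  by move=> k; rewrite (svalP k) mcompf1.
pose del i := projT1 (cid (del_ex i)).
have delP i : del i <o> q = gam i := projT2 (cid (del_ex i)).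
have q_epi (z : C) (u v : Hom e z) : u <o> q = v <o> q -> u = v.
  move=> uv; have [|w [_ w_uniq]] := q_univ _ (v <o> q).
    by move=> k; rewrite -!mcompA qE.
  by rewrite -(w_uniq u) // -(w_uniq v).
exists e, del => Y phi; have [h hP] := gam_weak Y phi.
exists (q <o> h); split=> [i|b bP]; first by rewrite mcompA delP.
have abE i : del i <o> (q <o> h) = del i <o> b by rewrite bP mcompA delP.
have [z [r [rE r_univ]]] := joint_coequalizer (fun _ : unit => q <o> h)
  (fun=> b) C_cocomplete.
have eps_ex i : exists eps : Hom z (X i), eps <o> r = del i.
  by have [|d [dP _]] := r_univ _ (del i); last by exists d.
have [w wP] := gam_weak z (fun i => projT1 (cid (eps_ex i))).
have kP i : gam i <o> (w <o> r <o> q) = gam i.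
  by rewrite !mcompA wP (projT2 (cid (eps_ex i))) delP.
have qwr : q <o> w <o> r = idm e.
  apply: q_epi; rewrite mcomp1f -!mcompA [w <o> _]mcompA.
  by rewrite (qE (exist _ _ kP)) mcompf1.
by rewrite -[q <o> h]mcomp1f -[b]mcomp1f -qwr -!(mcompA (q <o> w)) (rE tt).
Qed.

End Products.

(** * Uncountably directed posets *)

Lemma countable_lt (Lam : SmallType) :
  infinite_set [set: Lam] -> ~ countable [set: Lam] ->
  forall (T : SmallType) (A : set T), countable A -> card_lt A [set: Lam].
Proof.
move=> Lam_inf Lam_unc T A A_count; split.
  by apply: card_le_trans A_count _; exact/infiniteP.
by apply: contra_notN Lam_unc => /eq_countable <-.
Qed.

Section Directed.
Variables (Lam : SmallType) (P : poset).
Hypotheses (Lam_inf : infinite_set [set: Lam])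
  (Lam_unc : ~ countable [set: Lam]) (P_dir : lam_directed Lam P).

Lemma directed_seq (f : nat -> P) : exists u, forall n, ple (f n) u.
Proof.
have [|u uP] := P_dir (S := range f).
  by apply: countable_lt => //; exact: card_le_trans (card_image_le _ _) _.
by exists u => n; apply: uP; exists n.
Qed.

Lemma directed_pair (p q : P) : exists u, ple p u /\ ple q u.
Proof.
have [u uP] := directed_seq (fun n => if n is 0 then p else q).
by exists u; split; [exact: (uP 0)|exact: (uP 1)].
Qed.

Lemma directed_inhabited : inhabited P.
Proof.
have [|u _] := P_dir (S := set0); last by exists.
by apply: countable_lt => //; exact: countable0.
Qed.

Local Open Scope ereal_scope.

(** Uncountability at work: a decreasing function on an uncountably directed
    poset attains its infimum, because the witnesses of a sequence of
    approximations have a common upper bound. *)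
Lemma directed_attains (R : realType) (phi : P -> \bar R) :
  (forall p, 0 <= phi p) -> (forall p q, ple p q -> phi q <= phi p) ->
  exists p, forall q, phi p <= phi q.
Proof.
move=> phi_ge0 phi_decr; have [p0] := directed_inhabited.
pose m := ereal_inf (range phi).
have mP q : m <= phi q by apply: ereal_inf_lbound; exists q.
have m_ge0 : 0 <= m by apply: le_ereal_inf_tmp => _ [p _ <-].
have [m_fin|] := boolP (m \is a fin_num); last first.
  rewrite ge0_fin_numE // -leNgt leye_eq => /eqP m_oo.
  by exists p0 => q; rewrite (le_trans _ (mP q)) // m_oo leey.
have f_ex (n : nat) : exists p, phi p < m + (n.+1%:R^-1)%:E.
  have n_gt0 : (0 < n.+1%:R^-1 :> R)%R by rewrite invr_gt0.
  by have [_ [p _ <-] pP] := lb_ereal_inf_adherent n_gt0 m_fin; exists p.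
have [f fP] := choice f_ex; have [u uP] := directed_seq f.
exists u => q; apply: le_trans (mP q); apply/lee_addgt0Pr => e e_gt0.
have [n ne] : exists n, (n.+1%:R^-1 < e)%R.
  by exists (Num.trunc e^-1); rewrite invf_plt ?posrE // truncnS_gt.
rewrite (le_trans (phi_decr _ _ (uP n))) // (le_trans (ltW (fP n))) //.
by rewrite leeD2l // lee_fin ltW.
Qed.

End Directed.

(** * Directed colimits of generalized metric spaces *)

Section ExtendedLine.
Variable R : realType.
Local Open Scope ereal_scope.

(** The absolute difference, corrected at the diagonal, where it would be
    infinite for the infinite elements. *)
Definition ext_dist (a b : \bar R) : \bar R :=
  if a == b then 0 else `|a - b|.

Lemma ext_dist_is_gmetric : @is_gmetric R (\bar R) ext_dist.
Proof.
split=> [a b|a|a b|a b|a b c]; rewrite /ext_dist.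
- by case: ifP.
- by rewrite eqxx.
- case: eqP => // ab /eqP; rewrite abse_eq0.
  case: a b ab => [a||] [b||] //= ab /eqP[] /eqP.
  by rewrite subr_eq0 => /eqP ->.
- rewrite eq_sym; case: ifP => // _.
  by case: a b => [a||] [b||] //=; rewrite distrC.
- case: (eqVneq a c) => [_|ac].
    by apply: adde_ge0; case: ifP.
  case: (eqVneq a b) => [<-|ab]; first by rewrite add0e (negPf ac).
  case: (eqVneq b c) => [->|bc]; first by rewrite adde0.
  case: a b c ac ab bc => [a||] [b||] [c||] //= _ _ _.
  + by rewrite lee_fin -[(a - c)%R](subrKA b) ler_normD.
  + by rewrite leey.
  + by rewrite leey.
Qed.

(** The extended line, with infinite elements at distance [+oo] from all
    others: a generalized metric space with enough non-expansive maps into it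
    to compute distances in colimits. *)
Definition ext_line : gmetric R := GMetric ext_dist_is_gmetric.

Lemma le_ext_dist (a b : \bar R) : b - a <= ext_dist a b.
Proof.
rewrite /ext_dist; case: eqP => [->|].
  by case: b => [b||]; [rewrite subee|exact: leNye|exact: leNye].
by move=> _; rewrite -abseN; case: a b => [a||] [b||] //=;
  rewrite lee_fin opprB ler_norm.
Qed.

Lemma ext_dist_le (a b d : \bar R) : 0 <= a -> 0 <= b -> 0 <= d ->
  a <= b + d -> b <= a + d -> ext_dist a b <= d.
Proof.
rewrite /ext_dist; case: eqP => //.
case: a b d => [a||] [b||] [d||] //=; rewrite ?lee_fin ?leey //.
move=> _ _ _ _ ab ba.
by rewrite ler_distlC; apply/andP; rewrite lerBlDr; split.
Qed.

End ExtendedLine.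

Lemma met_ext (R : realType) (X Y : MetCat R) (f g : Hom X Y) :
  sval f =1 sval g -> f = g.
Proof.
by case: f g => [f fP] [g gP] fg; apply: eq_exist; exact/funext.
Qed.

Section MetColimits.
Variables (R : realType) (Lam : SmallType) (P : poset).
Hypotheses (Lam_inf : infinite_set [set: Lam])
  (Lam_unc : ~ countable [set: Lam]) (P_dir : lam_directed Lam P).
Variables (E : functor P (MetCat R)) (M : MetCat R) (t : cocone E M).
Hypothesis tP : is_colimit t.
Local Open Scope ereal_scope.

Let car (X : MetCat R) : Type := gcar X.
Let act (p q : P) (h : ple p q) : car (E p) -> car (E q) :=
  sval (@fmap P (MetCat R) E p q h).
Let leg (p : P) : car (E p) -> car M := sval (inj t p).

Let act_comp p q r (h : ple p q) (k : ple q r) (x : car (E p)) :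
  act k (act h x) = act (ple_trans h k) x.
Proof.
rewrite /act -[RHS]/(sval (@fmap P (MetCat R) E p r
  ((k : @Hom P q r) <o> (h : @Hom P p q))) x).
by rewrite fmap_comp.
Qed.

Let act_ne p q (h : ple p q) (x y : car (E p)) :
  gdist (act h x) (act h y) <= gdist x y.
Proof. exact: (svalP (@fmap P (MetCat R) E p q h)). Qed.

Let leg_act p q (h : ple p q) (x : car (E p)) : leg (act h x) = leg x.
Proof. by rewrite /leg -(@inj_nat P (MetCat R) E M t p q h). Qed.

(** The legs of a colimit of metric spaces are jointly surjective: the identity
    of the colimit factors through their joint image. *)
Lemma met_colimit_surj (m : car M) : exists (p : P) (x : car (E p)), leg x = m.
Proof.
pose im : set (car M) := [set m | exists (p : P) (x : car (E p)), leg x = m].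
pose N : SmallType := {m : car M | im m}.
have N_met : @is_gmetric R N (fun a b => gdist (sval a) (sval b)).
  have [ge0 refl eq0 sym tri] := gdist_is_gmetric M.
  split=> [a b|a|[a aP] [b bP] /= /eq0 ab|a b|a b c] //; first exact: eq_exist.
pose NM : MetCat R := GMetric N_met.
have im_leg p (x : car (E p)) : im (leg x) by exists p, x.
have leg'_ne p : @non_expansive R (E p) NM (fun x => exist _ _ (im_leg p x)).
  exact: (svalP (inj t p)).
have leg'P (p q : P) (h : @Hom P p q) :
    (exist _ _ (leg'_ne q) : Hom (E q) NM) <o> fmap E h = exist _ _ (leg'_ne p).
  apply: met_ext => x; apply: eq_exist; exact: leg_act.
have [u [uP _]] := tP (@Cocone P (MetCat R) E NM _ leg'P).
pose incl : Hom NM M := exist _ (fun a : N => sval a)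
  ((fun a b => lexx _) : @non_expansive R NM M (fun a : N => sval a)).
have inclu : incl <o> u = idm M.
  apply: (colimit_epi tP) => p; rewrite -mcompA uP mcomp1f.
  exact: met_ext.
have := svalP (sval u m).
by rewrite (_ : sval (sval u m) = m) // -[RHS]/(sval (idm M) m) -inclu.
Qed.

(** [f q z] is the least distance, over the stages beyond both [p] and [q],
    between the images of [x], living at stage [p], and [z], living at stage
    [q]. *)
Lemma met_stage_dist (p : P) (x : car (E p)) :
  exists f : forall q, car (E q) -> \bar R,
  (forall q z k (hp : ple p k) (hq : ple q k),
     f q z <= gdist (act hp x) (act hq z)) /\
  (forall q z, exists (k : P) (hp : ple p k) (hq : ple q k),
     f q z = gdist (act hp x) (act hq z)).
Proof.
pose phi q (z : car (E q)) (k : P) : \bar R :=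
  match pselect (ple p k), pselect (ple q k) with
  | left hp, left hq => gdist (act hp x) (act hq z)
  | _, _ => +oo
  end.
have phiE q z k (hp : ple p k) (hq : ple q k) :
    phi q z k = gdist (act hp x) (act hq z).
  rewrite /phi; case: pselect => // hp'; case: pselect => // hq'.
  by rewrite (Prop_irrelevance hp hp') (Prop_irrelevance hq hq').
have phi_ge0 q z k : 0 <= phi q z k.
  rewrite /phi; case: pselect => // hp; case: pselect => // hq.
  exact: gm_ge0 (gdist_is_gmetric _) _ _.
have phi_decr q z k k' : ple k k' -> phi q z k' <= phi q z k.
  move=> kk'; rewrite {2}/phi.
  case: pselect => [hp|_]; last exact: leey.
  case: pselect => [hq|_]; last exact: leey.
  rewrite (phiE _ _ _ (ple_trans hp kk') (ple_trans hq kk')) -!act_comp.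
  exact: act_ne.
have min_ex q z :=
  directed_attains Lam_inf Lam_unc P_dir (phi_ge0 q z) (phi_decr q z).
exists (fun q z => phi q z (projT1 (cid (min_ex q z)))); split=> q z.
  by move=> k hp hq; rewrite -phiE; exact: (projT2 (cid (min_ex q z))).
case: cid => k kP /=.
have [l [kl pl]] := directed_pair Lam_inf Lam_unc P_dir k p.
have [l' [ll' ql']] := directed_pair Lam_inf Lam_unc P_dir l q.
have kl' := ple_trans kl ll'; have pl' := ple_trans pl ll'.
exists l', pl', ql'; rewrite -phiE; apply/eqP; rewrite eq_le kP.
exact: phi_decr.
Qed.

(** Distances in an uncountably directed colimit are attained at some stage: the
    least distances to [x], as given by [met_stage_dist], form a cocone to the
    extended line, and the map that it induces is non-expansive. *)
Lemma met_colimit_dist (p : P) (x y : car (E p)) :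
  exists (k : P) (h : ple p k),
    gdist (act h x) (act h y) <= gdist (leg x) (leg y).
Proof.
have [f [f_le f_eq]] := met_stage_dist x.
have dist_ge0 (X : gmetric R) (a b : X) : 0 <= gdist a b.
  exact: gm_ge0 (gdist_is_gmetric _) _ _.
have f_ge0 q z : 0 <= f q z.
  by have [k [hp [hq ->]]] := f_eq q z; exact: dist_ge0.
have f_lip q (z z' : car (E q)) : f q z <= f q z' + gdist z z'.
  have [k [hp [hq ->]]] := f_eq q z'; apply: le_trans (f_le _ _ _ hp hq) _.
  apply: le_trans (gm_triangle (gdist_is_gmetric _) _ (act hq z') _) _.
  rewrite leeD2l //= (gm_sym (gdist_is_gmetric _) z z').
  exact: act_ne.
have f_ne q : @non_expansive R (E q) (ext_line R) (f q).
  move=> z z'; apply: ext_dist_le => //.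
  by rewrite (gm_sym (gdist_is_gmetric _)); exact: f_lip.
have f_nat (q r : P) (h : @Hom P q r) :
    (exist _ _ (f_ne r) : @Hom (MetCat R) (E r) (ext_line R)) <o> fmap E h =
    exist _ _ (f_ne q).
  apply: met_ext => z; apply/eqP; rewrite eq_le; apply/andP; split.
  - have [k [hp [hq fE]]] := f_eq q z.
    have [l [kl rl]] := directed_pair Lam_inf Lam_unc P_dir k r.
    rewrite /= [leRHS]fE; apply: le_trans (f_le _ _ _ (ple_trans hp kl) rl) _.
    rewrite -/(act h z) act_comp.
    rewrite (Prop_irrelevance (ple_trans h rl) (ple_trans hq kl)) -!act_comp.
    exact: act_ne.
  - have [k [hp [hr fE]]] := f_eq r (act h z).
    rewrite /= -/(act h z) [leRHS]fE act_comp; exact: f_le.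
have [u [uP _]] := tP (@Cocone P (MetCat R) E (ext_line R : MetCat R) _ f_nat).
have uE q z : sval u (leg z) = f q z.
  by have /(congr1 (fun w => sval w z)) := uP q.
have [k [hp [hq fy]]] := f_eq p y.
exists k, hp; rewrite {2}(Prop_irrelevance hp hq) -fy.
have fx : f p x = 0.
  apply/eqP; rewrite eq_le f_ge0 andbT.
  apply: le_trans (f_le _ _ _ hp hp) _.
  by rewrite (gm_refl (gdist_is_gmetric _)).
have := svalP u (leg x) (leg y); rewrite /= !uE fx; apply: le_trans.
by apply: le_trans (le_ext_dist _ _); rewrite sube0.
Qed.

End MetColimits.

(** * Presentable objects and injectivity *)

Section Enriched.
Variables (R : realType) (Lam : SmallType) (K : metCategory R).
Hypotheses (Lam_inf : infinite_set [set: Lam])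
  (Lam_unc : ~ countable [set: Lam]).
Local Open Scope ereal_scope.

Lemma mdist_post (A B C : K) (h : Hom B C) (f g : Hom A B) :
  mdist (h <o> f) (h <o> g) <= mdist f g.
Proof. exact: post_non_expansive. Qed.

Lemma mdist_pre (A B C : K) (f g : Hom B C) (h : Hom A B) :
  mdist (f <o> h) (g <o> h) <= mdist f g.
Proof. exact: pre_non_expansive. Qed.

Lemma esim_post (eps : \bar R) (A B C : K) (h : Hom B C) (f g : Hom A B) :
  esim eps f g -> esim eps (h <o> f) (h <o> g).
Proof. exact: le_trans (mdist_post _ _ _). Qed.

Lemma esim_sym (eps : \bar R) (A B : K) (f g : Hom A B) :
  esim eps f g -> esim eps g f.
Proof. by rewrite /esim (gm_sym (mdist_is_gmetric _ _)). Qed.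

Lemma esim_trans (d e : \bar R) (A B : K) (f g h : Hom A B) :
  esim d f g -> esim e g h -> esim (d + e) f h.
Proof.
move=> fg gh; apply: le_trans (gm_triangle (mdist_is_gmetric _ _) _ g _) _.
exact: leeD.
Qed.

Lemma esim_refl (eps : \bar R) (A B : K) (f : Hom A B) :
  0 <= eps -> esim eps f f.
Proof. by rewrite /esim (gm_refl (mdist_is_gmetric _ _)). Qed.

Lemma esim0 (A B : K) (f g : Hom A B) : esim 0 f g -> f = g.
Proof.
move=> fg; apply: (gm_eq (mdist_is_gmetric A B)); apply/eqP.
rewrite eq_le; apply/andP; split=> //.
exact: gm_ge0 (mdist_is_gmetric _ _) _ _.
Qed.

(** Conicality of a colimit does not depend on the choice of the cocone, so
    that one conical colimit of a diagram makes them all conical. *)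
Lemma colimit_conical (P : poset) (D : functor P K) (c : K) (s : cocone D c) :
  has_directed_colimits Lam K -> lam_directed Lam P -> is_colimit s ->
  is_conical_colimit s.
Proof.
move=> Kcol P_dir sP; split=> // B.
have [c' [s' [s'P s'B]]] := Kcol P D P_dir.
have [phi [phiE _]] := sP c' s'; have [psi [psiE _]] := s'P c s.
have psiphi : psi <o> phi = idm c.
  by apply: (colimit_epi sP) => j; rewrite -mcompA phiE psiE mcomp1f.
pose pre (X Y : K) (h : Hom X Y) :
    @Hom (MetCat R) (hom_met Y B) (hom_met X B) :=
  exist _ _ (pre_non_expansive (B := B) h).
move=> x t; have [u [uE u_uniq]] := s'B B x
  (@Cone _ _ (fcomp (met_cohom_functor B) (fop D)) x (prj t) (prj_nat t)).
exists (pre c c' phi <o> u); split=> [j|w wE].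
  rewrite -[RHS](uE j); apply: met_ext => z /=.
  by rewrite -mcompA phiE.
have -> : u = pre c' c psi <o> w.
  apply: u_uniq => j; rewrite -[RHS](wE j); apply: met_ext => z /=.
  by rewrite -mcompA psiE.
by apply: met_ext => z /=; rewrite -mcompA psiphi mcompf1.
Qed.

Section Stages.
Variables (P : poset) (D : functor P K) (c : K) (s : cocone D c).
Hypotheses (P_dir : lam_directed Lam P) (s_con : is_conical_colimit s).
Variable A : K.
Hypothesis A_pres : met_presentable Lam A.

Lemma presentable_factor (v : Hom A c) :
  exists (p : P) (x : Hom A (D p)), inj s p <o> x = v.
Proof. exact: (met_colimit_surj (A_pres P_dir s_con)). Qed.

Lemma presentable_esim (eps : \bar R) (p : P) (x y : Hom A (D p)) :
  esim eps (inj s p <o> x) (inj s p <o> y) ->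
  exists (k : P) (h : @Hom P p k), esim eps (fmap D h <o> x) (fmap D h <o> y).
Proof.
have [k [h hP]] :=
  met_colimit_dist Lam_inf Lam_unc P_dir (A_pres P_dir s_con) x y.
by exists k, h; apply: le_trans hP _.
Qed.

End Stages.

Hypothesis K_directed_colimits : has_directed_colimits Lam K.
Variables (S : SmallType) (G : S -> K).
Hypothesis G_presentable : forall i, met_presentable Lam (G i).
Hypothesis G_gen : forall X : K,
  exists (P : poset) (D : functor P K) (s : cocone D X),
    [/\ lam_directed Lam P, is_colimit s & forall p, in_family G (D p)].

Lemma in_family_presentable (A : K) : in_family G A -> met_presentable Lam A.
Proof. by case=> i ->. Qed.

(** A square commuting up to [eps] between presentable objects and a fixed
    object [c] is already defined over a member of [G]. *)
Lemma square_factor (eps : \bar R) (A A' B c : K) (g : Hom A B)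
  (a : Hom A A') (x : Hom A' c) (v : Hom B c) :
  met_presentable Lam A -> met_presentable Lam A' -> met_presentable Lam B ->
  esim eps (v <o> g) (x <o> a) ->
  exists (C : K) (z : Hom C c) (k : Hom A' C) (y : Hom B C),
    [/\ in_family G C, z <o> k = x, z <o> y = v & esim eps (y <o> g) (k <o> a)].
Proof.
move=> A_pres A'_pres B_pres vgxa.
have [P [D [s [P_dir sP DG]]]] := G_gen c.
have s_con := colimit_conical K_directed_colimits P_dir sP.
have [p [x0 x0E]] := presentable_factor P_dir s_con A'_pres x.
have [q [v0 v0E]] := presentable_factor P_dir s_con B_pres v.
have [l [pl ql]] := directed_pair Lam_inf Lam_unc P_dir p q.
have [x1 x1E] : exists x1, inj s l <o> x1 = x.
  by exists (fmap D (pl : @Hom P p l) <o> x0); rewrite mcompA inj_nat.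
have [v1 v1E] : exists v1, inj s l <o> v1 = v.
  by exists (fmap D (ql : @Hom P q l) <o> v0); rewrite mcompA inj_nat.
have [|k [lk e]] := @presentable_esim P D c s P_dir s_con A A_pres eps l
    (v1 <o> g) (x1 <o> a); first by rewrite !mcompA x1E v1E.
exists (D k), (inj s k), (fmap D lk <o> x1), (fmap D lk <o> v1).
split=> //; rewrite ?mcompA ?inj_nat //.
by rewrite -!mcompA.
Qed.

(** An ordinary [Lam]-pure morphism is weakly [Lam]-[e]-pure for each [e]:
    a square commuting up to [e] is induced from a strictly commuting one, by
    [square_factor]. Thus a class closed under weakly [e]-pure morphisms is
    closed under weakly [0]-pure ones. *)
Lemma weakly_pure0 (e : \bar R) (X Y : K) (f : Hom X Y) :
  0 <= e -> weakly_pure Lam 0 f -> weakly_pure Lam e f.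
Proof.
move=> e_ge0 f_pure A B A_pres B_pres g u v fuvg.
have [P [D [s [P_dir sP DG]]]] := G_gen X.
have s_con := colimit_conical K_directed_colimits P_dir sP.
have [i [u0 u0E]] := presentable_factor P_dir s_con A_pres u.
have Di_pres := in_family_presentable (DG i).
have [|C [z [k [y [CG zk zy ykg]]]]] := @square_factor e A (D i) B Y g u0
    (f <o> inj s i) v A_pres Di_pres B_pres.
  by rewrite -mcompA u0E; exact: esim_sym.
have [|t tk] := f_pure _ _ Di_pres (in_family_presentable CG) k (inj s i) z.
  by rewrite zk; exact: esim_refl.
have {}tk : t <o> k = inj s i by apply: esim0; rewrite mule0 in tk.
exists (t <o> y).
have tyg : esim e (t <o> y <o> g) u.
  by rewrite -u0E -tk -!mcompA; exact: esim_post.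
by apply: le_trans tyg _; rewrite mule_natl mule2n leeDl.
Qed.

Variables (L : K -> Prop) (eps : \bar R).
Hypothesis eps_ge0 : 0 <= eps.
Hypothesis K_products : forall (I : SmallType) (X : I -> K),
  exists (p : K) (pi : forall i, Hom p (X i)), is_product pi.
Hypothesis L_products : closed_under_products L.
Hypothesis L_directed_colimits : closed_under_directed_colimits Lam L.

(** The morphisms to which every object of [L] is [eps]-injective. *)
Definition all_injective (A B : K) (f : Hom A B) : Prop :=
  forall Y, L Y -> injective_to eps f Y.

(** Each [A] has a map [h] to an object of [L] that detects [all_injective]:
    [h] factors through [k : A -> B] only if every object of [L] is
    [eps]-injective to [k]. It is the product of the witnesses against all
    the other [k]. *)
Lemma detecting_map (A : K) : exists (Z : K) (h : Hom A Z), L Z /\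
  forall (B : K) (k : Hom A B), in_family G B ->
    (exists z : Hom B Z, z <o> k = h) -> all_injective k.
Proof.
pose I : SmallType := {b : S & {k : Hom A (G b) | ~ all_injective k}}.
have wit (i : I) : exists Yg : {Y : K & Hom A Y}, L (tag Yg) /\
    ~ exists w, esim eps (w <o> sval (tagged i)) (tagged Yg).
  case: i => b [k k_bad] /=; apply: contra_notP k_bad => no_wit Y LY g.
  by apply: contra_notP no_wit => no_w; exists (Tagged _ g).
have [Yg YgP] := choice wit.
have [Z [pi piP]] := K_products (fun i => tag (Yg i)).
have [h [hE _]] := piP A (fun i => tagged (Yg i)).
exists Z, h; split; first by apply: L_products piP _ => i; case: (YgP i).
move=> B k [b BE]; case: _ / (esym BE) in k * => -[z zk].
apply: contrapT => k_bad; pose i : I := existT _ b (exist _ k k_bad).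
have [_] := YgP i; apply; exists (pi i <o> z).
by rewrite -mcompA /= zk hE; exact: esim_refl.
Qed.

Hypothesis L_weakly_pure : closed_under_weakly_pure Lam eps L.

(** The heart of the argument: an object that is [eps]-injective to every
    morphism of [G] to which all of [L] is [eps]-injective maps to a reduced
    product of objects of [L] by a weakly pure morphism. *)
Lemma injective_in_class (X : K) :
  (forall (A B : K) (f : Hom A B), in_family G A -> in_family G B ->
     all_injective f -> injective_to eps f X) ->
  L X.
Proof.
move=> X_inj; have [P [D [s [P_dir sP DG]]]] := G_gen X.
have s_con := colimit_conical K_directed_colimits P_dir sP.
have [Z [h [LZ h_det]]] : exists (Z : P -> K) (h : forall j, Hom (D j) (Z j)),
    (forall j, L (Z j)) /\
    forall j (B : K) (k : Hom (D j) B), in_family G B ->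
      (exists z : Hom B (Z j), z <o> k = h j) -> all_injective k.
  pose det (j : P) := cid (detecting_map (D j)).
  exists (fun j => projT1 (det j)), (fun j => projT1 (cid (projT2 (det j)))).
  by split=> j; case: (projT2 (cid (projT2 (det j)))).
(* The reduced product of the [Z j]: the colimit of the products of the tails. *)
pose up (i : P) : SmallType := {j : P | ple i j}.
pose up_le i k (ik : ple i k) (j : up k) : up i :=
  exist _ (sval j) (ple_trans ik (svalP j)).
have [Q [pi piP]] : exists (Q : P -> K)
    (pi : forall i (j : up i), Hom (Q i) (Z (sval j))),
    forall i, is_product (pi i).
  pose prodQ (i : P) := cid (K_products (fun j : up i => Z (sval j))).
  exists (fun i => projT1 (prodQ i)).
  exists (fun i => projT1 (cid (projT2 (prodQ i)))).
  by move=> i; exact: (projT2 (cid (projT2 (prodQ i)))).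
have pi_ext i (Y : K) (a b : Hom Y (Q i)) :
    (forall j, pi i j <o> a = pi i j <o> b) -> a = b.
  move=> ab; have [w [_ w_uniq]] := piP i Y (fun j => pi i j <o> b).
  by rewrite -(w_uniq a) // -(w_uniq b).
have res_ex (i k : P) (ik : ple i k) : exists res : Hom (Q i) (Q k),
    forall j, pi k j <o> res = pi i (up_le i k ik j).
  by have [w [wE _]] := piP k (Q i) (fun j => pi i (up_le i k ik j)); exists w.
pose res i k ik := projT1 (cid (res_ex i k ik)).
have resE i k ik j : pi k j <o> res i k ik = pi i (up_le i k ik j).
  exact: (projT2 (cid (res_ex i k ik))).
have res_id i : res i i (ple_refl i) = idm (Q i).
  apply: pi_ext => -[j ij]; rewrite resE mcompf1.
  rewrite /up_le /=; congr (pi i (exist _ j _)); exact: Prop_irrelevance.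
have res_comp (i j k : P) (jk : ple j k) (ij : ple i j) :
    res i k (ple_trans ij jk) = res j k jk <o> res i j ij.
  apply: pi_ext => -[l kl]; rewrite mcompA !resE.
  apply: etrans (esym (resE i j ij (up_le j k jk (exist _ l kl)))).
  rewrite /up_le /=; congr (pi i (exist _ l _)); exact: Prop_irrelevance.
pose QF : functor P K := @Functor P K Q res res_id res_comp.
have [q [t t_con]] := K_directed_colimits QF P_dir.
have Lq : L q.
  by apply: L_directed_colimits P_dir t_con _ => i; exact: L_products (piP i) _.
have m_ex (i : P) : exists m : Hom (D i) (Q i), forall j : up i,
    pi i j <o> m = h (sval j) <o> fmap D (svalP j : @Hom P i (sval j)).
  have [w [wE _]] := piP i (D i)
    (fun j : up i => h (sval j) <o> fmap D (svalP j : @Hom P i (sval j))).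
  by exists w.
pose m i := projT1 (cid (m_ex i)).
have mE i (j : up i) :
    pi i j <o> m i = h (sval j) <o> fmap D (svalP j : @Hom P i (sval j)).
  exact: (projT2 (cid (m_ex i))).
have m_nat (i k : P) (ik : ple i k) :
    res i k ik <o> m i = m k <o> fmap D (ik : @Hom P i k).
  apply: pi_ext => -[j kj]; rewrite !mcompA resE mE.
  apply: etrans (mE i (up_le i k ik (exist _ j kj))) _.
  rewrite -mcompA -fmap_comp; congr (h j <o> fmap D _).
  exact: (@Prop_irrelevance (ple i j)).
have t_nat (i k : P) (ik : ple i k) : inj t k <o> res i k ik = inj t i.
  exact: (@inj_nat P K QF q t i k ik).
have r_nat (i k : P) (ik : @Hom P i k) :
    inj t k <o> m k <o> fmap D ik = inj t i <o> m i.
  by rewrite -mcompA -m_nat mcompA t_nat.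
have [r [rE _]] := sP q (@Cocone P K D q (fun i => inj t i <o> m i) r_nat).
(* It remains to see that [r] is weakly pure: the given square is first lifted to
   a common stage [l], then to a stage [k] where it commutes up to [eps]. *)
apply: (L_weakly_pure (f := r)) Lq => A B A_pres B_pres g u v ruvg.
have [i [u0 u0E]] := presentable_factor P_dir s_con A_pres u.
have [j [v0 v0E]] := presentable_factor P_dir t_con B_pres v.
have [l [il jl]] := directed_pair Lam_inf Lam_unc P_dir i j.
have [u1 u1E] : exists u1, inj s l <o> u1 = u.
  by exists (fmap D (il : @Hom P i l) <o> u0); rewrite mcompA inj_nat.
have [v1 v1E] : exists v1, inj t l <o> v1 = v.
  by exists (res j l jl <o> v0); rewrite mcompA t_nat.
have [|k [lk e]] := presentable_esim P_dir t_con A_pres (p := l) (eps := eps)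
    (x := m l <o> u1) (y := v1 <o> g).
  by rewrite !mcompA v1E -[inj t l <o> m l]rE -mcompA u1E.
pose u2 := fmap D lk <o> u1; pose w := pi k (exist _ k (ple_refl k)).
have wm : w <o> m k = h k.
  apply: etrans (mE k (exist _ k (ple_refl k))) _.
  rewrite /= -[RHS]mcompf1 -(fmap_id D k); congr (h k <o> fmap D _).
  exact: (@Prop_irrelevance (ple k k)).
(* Projecting [Q k] to its first factor [Z k] gives a square over [h k]. *)
have {}e : esim eps (w <o> res l k lk <o> v1 <o> g) (h k <o> u2).
  apply: esim_sym; move: (esim_post w e).
  by rewrite /= !mcompA -(mcompA w) m_nat mcompA wm.
have [C [z [kap [y [CG zk zy ykap]]]]] := square_factor A_pres
  (in_family_presentable (DG k)) B_pres e.
have kap_inj : all_injective kap by apply: (h_det k) => //; exists z.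
have [x xE] := X_inj _ _ kap (DG k) CG kap_inj (inj s k).
exists (x <o> y).
have u2E : inj s k <o> u2 = u by rewrite /u2 mcompA inj_nat.
have -> : 2%:E * eps = eps + eps by rewrite mule_natl mule2n.
apply: (@esim_trans _ _ _ _ _ (x <o> (kap <o> u2))).
  by rewrite -mcompA; exact: esim_post.
rewrite -[X in esim _ _ X]u2E mcompA; exact: le_trans (mdist_pre _ _ _) xE.
Qed.

End Enriched.

Theorem theorem4p8 (R : realType) (Lam : SmallType)
  (Lam_regular : regular_cardinal Lam)
  (Lam_uncountable : ~ countable [set: Lam]%classic)
  (eps : \bar R) (eps_ge0 : (0 <= eps)%E)
  (K : metCategory R)
  (K_directed_colimits : has_directed_colimits Lam K)
  (K_locally_presentable : locally_presentable Lam K)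
  (K_presentable : forall A : K, presentable Lam A -> met_presentable Lam A)
  (L : K -> Prop)
  (L_products : closed_under_products L)
  (L_directed_colimits : closed_under_directed_colimits Lam L)
  (L_weakly_pure : closed_under_weakly_pure Lam eps L) :
  injectivity_class Lam eps L /\ small_injectivity_class L.
Proof.
have [Lam_inf _] := Lam_regular.
have [K_cocomplete [S [G [G_pres G_gen]]]] := K_locally_presentable.
have G_met i : met_presentable Lam (G i) by exact: K_presentable.
have K_products (I : SmallType) (X : I -> K) :
    exists (p : K) (pi : forall i, Hom p (X i)), is_product pi.
  apply: (product_exists (G := G)) => // Y.
  by have [P [D [s [_ sP DG]]]] := G_gen Y; exists P, D, s.
have L_weakly_pure0 : closed_under_weakly_pure Lam 0%E L.
  move=> X Y f f_pure; apply: (L_weakly_pure X Y f).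
  exact: weakly_pure0 f_pure.
split.
  exists (fun A B f => [/\ met_presentable Lam A, met_presentable Lam B &
    all_injective L eps f]).
  split=> [A B f []//|X]; split=> [LX A B f [_ _ f_inj]|X_inj].
    exact: f_inj.
  apply: (@injective_in_class R Lam K Lam_inf Lam_uncountable _ S G _ _ L eps)
    => // A B f AG BG f_inj.
  by apply: X_inj; split=> //; exact: in_family_presentable G_met _ _.
pose I : SmallType :=
  {a : S & {b : S & {f : Hom (G a) (G b) | all_injective L 0%E f}}}.
exists I, (fun i : I => G (tag i)), (fun i : I => G (tag (tagged i))),
  (fun i : I => sval (tagged (tagged i))).
move=> X; split=> [LX i|X_inj]; first exact: svalP (tagged (tagged i)) X LX.
apply: (@injective_in_class R Lam K Lam_inf Lam_uncountable _ S G _ _ L 0%E)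
  => // A B f [a AE] [b BE].
case: _ / (esym AE) in f *; case: _ / (esym BE) in f * => f_inj.
exact: (X_inj (existT _ a (existT _ b (exist _ f f_inj)))).
Qed.
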